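(* Let $p$ be an odd prime, $g\ge 1$ an integer, and $m=(p-1)/2$. The following identities hold in $\mathbb{F}_p[z_1,\ldots,z_{2g-1}]$. (i) For every $k\in\{1,\ldots,2g-1\}$, every $j$ with $1\le j<g$, and every $i$ with $1\le i\le g$, $$z_k\,\partial_k c_{ip-j}-m\,c_{ip-j}=\partial_k c_{ip-(j+1)}.$$ (ii) For every $j$ with $1\le j<g$ and every $i$ with $1\le i\le g$, $$\left(\sum_{k=1}^{2g-1}(z_k-1)\partial_k\right)c_{ip-(j+1)}=(m-j+1)\,c_{ip-j}+(m-g+j+1)\,c_{ip-(j+1)}.$$
   Context: Let $f(x)=x(x-1)(x-z_1)(x-z_2)\cdots(x-z_{2g-1})$ with $z_1,\ldots,z_{2g-1}$ indeterminates over $\mathbb{F}_p$. For an integer $k$, $c_k\in\mathbb{F}_p[z_1,\ldots,z_{2g-1}]$ denotes the coefficient of $x^k$ in $f(x)^{(p-1)/2}$ (so $c_k=0$ if $k<0$ or $k>(p-1)(2g+1)/2$). We write $\partial_k=\partial/\partial z_k$. Integers such as $m-j+1$ are regarded as elements of $\mathbb{F}_p$. *)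

(* Defs.v *)
From mathcomp Require Import all_boot all_order all_algebra.
From mathcomp Require Import mpoly.

Set Implicit Arguments.
Unset Strict Implicit.
Unset Printing Implicit Defensive.

Import GRing.Theory.
Local Open Scope ring_scope.

(* The indeterminates z_1, ..., z_{2g-1} are 'X_0, ..., 'X_{2g-2}; for p prime,
   'F_p is the field with p elements. *)
Definition fpol (p g : nat) : {poly {mpoly 'F_p[(2 * g - 1)%N]}} :=
  'X * ('X - 1) * \prod_(k < (2 * g - 1)%N) ('X - ('X_k)%:P).

(* Indexed by int because the index i * p - j may be negative when p <= g. *)
Definition ccoef (p g : nat) (k : int) : {mpoly 'F_p[(2 * g - 1)%N]} :=
  match k with
  | Posz n => (fpol p g ^+ ((p - 1) %/ 2)%N)`_n
  | Negz _ => 0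
  end.

(* Main.v *)
Require Import Defs.
From mathcomp Require Import all_boot all_order all_algebra.
From mathcomp Require Import mpoly.
From mathcomp Require Import ring.

Import GRing.Theory.
Local Open Scope ring_scope.

(* Put [F := f ^+ m]. Both identities are coefficient extractions from
   first-order differential equations for [F]:
     [(x - z_k) * d_k F = - m F]  and
     [x * ((x - 1) * F' + \sum_k (z_k - 1) d_k F) = m ((N + 2) x - 1) F],
   where [N = 2 g - 1] is the number of indeterminates [z_k]. The operator in the
   second one is a derivation chosen so that every factor of [f] other than
   [x] is an eigenvector for the eigenvalue 1. Modulo [p], one has
   [i p - j = - j] and [2 m = - 1]. *)

Definition leibniz {R : pzRingType} (D : R -> R) : Prop :=
  forall a b, D (a * b) = D a * b + a * D b.

(* [x] times the logarithmic derivative of [a] is [s], without division. *)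
Definition logder {R : pzRingType} (D : R -> R) (x a s : R) : Prop :=
  x * D a = s * a.

Section LogarithmicDerivative.
Variables (R : comPzRingType) (D : R -> R) (x : R).
Hypothesis DM : leibniz D.

Lemma leibniz1 : D 1 = 0.
Proof.
have := DM 1 1; rewrite !mulr1 mul1r => e.
by apply: (addrI (D 1)); rewrite addr0 -e.
Qed.

Lemma logder1 : logder D x 1 0.
Proof. by rewrite /logder leibniz1 mulr0 mul0r. Qed.

Lemma logderM a b s t :
  logder D x a s -> logder D x b t -> logder D x (a * b) (s + t).
Proof.
rewrite /logder DM => Da Db.
by rewrite mulrDr mulrA Da mulrCA Db; ring.
Qed.

Lemma logder_prod (I : finType) (F s : I -> R) :
  (forall i, logder D x (F i) (s i)) ->
  logder D x (\prod_i F i) (\sum_i s i).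
Proof.
by move=> DF; apply: (big_ind2 (logder D x)) => //;
  [exact: logder1 | move=> *; exact: logderM].
Qed.

Lemma logderX a s n : logder D x a s -> logder D x (a ^+ n) (s *+ n).
Proof.
move=> Da; elim: n => [|n IHn]; first exact: logder1.
by rewrite exprS mulrS; apply: logderM.
Qed.

End LogarithmicDerivative.

Lemma map_poly_leibniz (R : comNzRingType) (d : {additive R -> R}) :
  leibniz d -> leibniz (map_poly d).
Proof.
move=> dM P Q; apply/polyP => n.
rewrite coefD coef_map /= !coefM raddf_sum -big_split /=.
by apply: eq_bigr => i _; rewrite dM !coef_map.
Qed.

(** Extending by zero to negative indices makes multiplication by ['X] a shift of the index at every
    integer, with no boundary case. *)
Definition icoef {R : nzRingType} (P : {poly R}) (n : int) : R :=
  if n is Posz i then P`_i else 0.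

Section IntegerIndexedCoefficients.
Variable R : nzRingType.
Implicit Types (P Q : {poly R}) (n : int).

Lemma icoefD P Q n : icoef (P + Q) n = icoef P n + icoef Q n.
Proof. by case: n => i /=; rewrite ?coefD ?addr0. Qed.

Lemma icoefN P n : icoef (- P) n = - icoef P n.
Proof. by case: n => i /=; rewrite ?coefN ?oppr0. Qed.

Lemma icoefMn P k n : icoef (P *+ k) n = icoef P n *+ k.
Proof. by case: n => i /=; rewrite ?coefMn ?mul0rn. Qed.

Lemma icoef_sum (I : finType) (P : I -> {poly R}) n :
  icoef (\sum_i P i) n = \sum_i icoef (P i) n.
Proof. by case: n => i /=; [rewrite coef_sum | rewrite big1]. Qed.

Lemma icoefCM a P n : icoef (a%:P * P) n = a * icoef P n.
Proof. by case: n => i /=; rewrite ?coefCM ?mulr0. Qed.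

Lemma icoefXM P n : icoef ('X * P) n = icoef P (n - 1).
Proof.
case: n => [[|i]|i]; rewrite /= ?coefXM //=.
by rewrite subn1.
Qed.

(** At [n = 0] the left index is -1 and the right multiplier is 0, so both sides vanish. *)
Lemma icoef_deriv P n : icoef P^`() (n - 1) = icoef P n *~ n.
Proof.
rewrite -icoefXM; case: n => [[|i]|i]; rewrite /= ?coefXM ?mul0rz //=.
by rewrite coef_deriv.
Qed.

Lemma icoef_map (d : {additive R -> R}) P n :
  icoef (map_poly d P) n = d (icoef P n).
Proof. by case: n => i /=; rewrite ?coef_map ?raddf0. Qed.

End IntegerIndexedCoefficients.

Section MasterPolynomial.
Variables (p g m : nat).
Local Notation N := (2 * g - 1)%N.
Local Notation A := {mpoly 'F_p[N]}.
Local Notation f := (fpol p g).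
Local Notation pd k := (map_poly (mderiv (R := 'F_p) (n := N) k)).

Lemma pd_leibniz k : leibniz (pd k).
Proof. by apply: map_poly_leibniz => a b; exact: mderivM. Qed.

Lemma pdX k : pd k 'X = 0.
Proof.
apply/polyP => i; rewrite coef_map coefX coef0.
by case: (_ == _); rewrite /= ?raddf0 // -mpolyC1 mderivC.
Qed.

Lemma pdC k (a : A) : pd k a%:P = (mderiv k a)%:P.
Proof. exact: map_polyC. Qed.

Lemma pd1 k : pd k 1 = 0.
Proof. exact: leibniz1 (pd_leibniz k). Qed.

Lemma pdB k P Q : pd k (P - Q) = pd k P - pd k Q.
Proof. exact: raddfB. Qed.

Lemma icoef_pd k P n : icoef (pd k P) n = mderiv k (icoef P n).
Proof. exact: icoef_map. Qed.

Lemma mderiv_var (k l : 'I_N) : mderiv k ('X_l : A) = (k == l)%:R.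
Proof.
rewrite mderivX mnm1E eq_sym; case: eqP => [->|_]; last by rewrite scale0r.
by rewrite scale1r -[X in (X - _)%MM]add0m addmK mpolyX0.
Qed.

(** Only the factor ['X - ('X_k)%:P] of [f] involves ['X_k], and its derivative is -1; multiplying
    by that factor clears the denominator. *)
Lemma pd_fpol k : logder (pd k) ('X - ('X_k)%:P) f (-1).
Proof.
rewrite -[-1]add0r /fpol; apply: logderM; first exact: pd_leibniz.
  by rewrite /logder (pd_leibniz k 'X) pdB pdX pd1 subrr mulr0 !mul0r addr0 mulr0.
(* Spreading -1 over the factors, with weight 0 away from [k], gives the shape required by
   [logder_prod]. *)
have -> : -1 = \sum_(l < N) (- (k == l)%:R) :> {poly A}.
  rewrite (bigD1 k) //= eqxx big1 ?addr0 // => l /negPf.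
  by rewrite eq_sym => ->; rewrite oppr0.
apply: logder_prod; first exact: pd_leibniz.
move=> l; rewrite /logder pdB pdX pdC mderiv_var sub0r.
case: eqP => [->|_]; first by rewrite polyC1 mulrC.
by rewrite polyC0 oppr0 mulr0 mul0r.
Qed.

(** This is the infinitesimal dilation centred at 1, acting on ['X] and all the ['X_k] together;
    hence differences of these variables, and their differences with 1, have weight 1. *)
Definition euler (P : {poly A}) : {poly A} :=
  ('X - 1) * P^`() + \sum_(k < N) ('X_k - 1)%:P * pd k P.

Lemma euler_leibniz : leibniz euler.
Proof.
move=> P Q; rewrite /euler derivM.
under eq_bigr => k _ do rewrite pd_leibniz mulrDr mulrA (mulrCA _ P).
by rewrite big_split /= -mulr_suml -mulr_sumr; ring.
Qed.

Lemma eulerX : euler 'X = 'X - 1.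
Proof.
by rewrite /euler derivX mulr1 big1 ?addr0 // => k _; rewrite pdX mulr0.
Qed.

Lemma eulerXsub1 : euler ('X - 1) = 'X - 1.
Proof.
(* The constant 1 is restated as [1%:P] so that [derivXsubC] applies. *)
have -> : euler ('X - 1) = ('X - 1) * ('X - (1 : A)%:P)^`()
    + \sum_(k < N) ('X_k - 1)%:P * pd k ('X - 1) by [].
rewrite derivXsubC mulr1 big1 ?addr0 // => k _.
by rewrite pdB pdX pd1 subrr mulr0.
Qed.

Lemma eulerXsubvar (l : 'I_N) : euler ('X - ('X_l)%:P) = 'X - ('X_l)%:P.
Proof.
rewrite /euler derivXsubC mulr1 (bigD1 l) //= big1 => [|k /negPf kl].
  (* The one surviving term of the sum gives (x - 1) - (z_l - 1) = x - z_l. *)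
  by rewrite pdB pdX pdC mderiv_var eqxx polyC1 polyCB; ring.
by rewrite pdB pdX pdC mderiv_var kl polyC0 subr0 mulr0.
Qed.

(** The factor x contributes x - 1, and each of the [N + 1] eigenvectors contributes x. *)
Lemma euler_fpol : logder euler 'X f ('X - 1 + 'X + 'X *+ N).
Proof.
rewrite /fpol; apply: logderM; first exact: euler_leibniz.
  apply: logderM; first exact: euler_leibniz.
    by rewrite /logder eulerX mulrC.
  by rewrite /logder eulerXsub1.
have -> : 'X *+ N = \sum_(l < N) 'X :> {poly A} by rewrite sumr_const card_ord.
apply: logder_prod; first exact: euler_leibniz.
by move=> l; rewrite /logder eulerXsubvar.
Qed.

Lemma icoef_pd_fpolX (k : 'I_N) (n : int) :
  'X_k * mderiv k (icoef (f ^+ m) n) - icoef (f ^+ m) n *+ m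
    = mderiv k (icoef (f ^+ m) (n - 1)).
Proof.
have /(congr1 (fun P => icoef P n)) := logderX _ _ _ (pd_leibniz k) _ _ m (pd_fpol k).
rewrite mulrBl mulNrn mulNr mulr_natl.
(* With c_n the coefficient of x^n in [f ^+ m], the equation becomes d_k c_(n-1) - z_k d_k c_n = - m
   c_n. *)
rewrite icoefD !icoefN icoefMn icoefCM icoefXM !icoef_pd => e.
by rewrite -[RHS](subrK ('X_k * mderiv k (icoef (f ^+ m) n))) e addrC.
Qed.

Lemma icoef_euler_fpolX (n : int) :
  \sum_(k < N) ('X_k - 1) * mderiv k (icoef (f ^+ m) (n - 1))
    = icoef (f ^+ m) n *~ (n - m%:Z)
      + icoef (f ^+ m) (n - 1) *~ (m%:Z * (N%:Z + 2) - (n - 1)).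
Proof.
have /(congr1 (fun P => icoef P n)) := logderX _ _ _ euler_leibniz _ _ m euler_fpol.
set F := f ^+ m.
have -> : 'X * euler F = 'X * ('X * F^`()) - 'X * F^`()
          + 'X * \sum_(k < N) ('X_k - 1)%:P * pd k F.
  by rewrite /euler; ring.
have -> : ('X - 1 + 'X + 'X *+ N) *+ m * F = ('X * F) *+ (m * (N + 2)) - F *+ m.
  have -> : 'X - 1 + 'X + 'X *+ N = 'X *+ (N + 2) - 1 :> {poly A}.
    rewrite mulrnDr mulr2n.
    have addE (x y : {poly A}) : x - 1 + x + y = y + (x + x) - 1 by ring.
    exact: addE.
  by rewrite mulrnAl mulrBl mul1r mulrnBl mulrnAl -mulrnA (mulnC m).
rewrite !icoefD !icoefN !icoefMn !icoefXM !icoef_deriv icoef_sum.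
under eq_bigr => k _ do rewrite icoefCM icoef_pd.
(* The added terms come from (x - 1) F' multiplied by x; with them the left side becomes that of
   [e]. *)
move=> e; apply: (addrI (icoef F (n - 1) *~ (n - 1) - icoef F n *~ n)).
have cancel (x y z t : A) : z - t = x - y + (y - t + (z - x)) by ring.
by rewrite e !mulrzBr; exact: cancel.
Qed.

End MasterPolynomial.

Theorem theorem3p5 (p g m : nat) (p_prime : prime p) (p_odd : odd p)
    (g_ge1 : (1 <= g)%N) (m_def : m = ((p - 1) %/ 2)%N) :
  (forall (k : 'I_(2 * g - 1)%N) (j i : nat),
      (1 <= j)%N -> (j < g)%N -> (1 <= i)%N -> (i <= g)%N ->
      'X_k * mderiv k (ccoef p g ((i * p)%N%:Z - j%:Z))
        - (m%:R : 'F_p) *: ccoef p g ((i * p)%N%:Z - j%:Z)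
      = mderiv k (ccoef p g ((i * p)%N%:Z - (j + 1)%N%:Z)))
  /\
  (forall j i : nat,
      (1 <= j)%N -> (j < g)%N -> (1 <= i)%N -> (i <= g)%N ->
      \sum_(k < (2 * g - 1)%N)
         ('X_k - 1) * mderiv k (ccoef p g ((i * p)%N%:Z - (j + 1)%N%:Z))
      = ((m%:Z - j%:Z + 1)%:~R : 'F_p) *: ccoef p g ((i * p)%N%:Z - j%:Z)
        + ((m%:Z - g%:Z + j%:Z + 1)%:~R : 'F_p)
            *: ccoef p g ((i * p)%N%:Z - (j + 1)%N%:Z)).
Proof.
have pred j i : (i * p)%N%:Z - (j + 1)%N%:Z = (i * p)%N%:Z - j%:Z - 1.
  by rewrite PoszD opprD addrA.
have cE n : ccoef p g n = icoef (fpol p g ^+ m) n by rewrite m_def; case: n.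
(* Oddness of [p] makes the halving in [m] exact. *)
have pE : p%:Z = 2 * m%:Z + 1.
  have m2 : (2 * m = p - 1)%N.
    by rewrite m_def divn2 mul2n halfK oddB ?odd_gt0 // p_odd subn0.
  by rewrite -PoszM m2 -PoszD subnK ?odd_gt0.
have pF (k : int) : (k * p%:Z)%:~R = 0 :> 'F_p.
  by rewrite intrM -[p%:~R]/(p%:R) pchar_Fp_0 ?mulr0.
split=> [k j i _ _ _ _ | j i _ _ _ _].
  by rewrite pred !cE scaler_nat icoef_pd_fpolX.
rewrite pred !cE icoef_euler_fpolX -!scaler_int; congr (_ *: _ + _ *: _).
  (* Since - m = m + 1 - p, one copy of [p] is taken from [i * p]. *)
  have -> : (i * p)%N%:Z - j%:Z - m%:Z
      = m%:Z - j%:Z + 1 + (i%:Z - 1) * p%:Z by rewrite PoszM pE; ring.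
  by rewrite intrD pF addr0.
(* Here m (2 g + 1) = m + g (p - 1), which supplies both - g and the multiple g p; [1 <= g] makes
   the natural subtraction [2 * g - 1] a true one. *)
have -> : m%:Z * ((2 * g - 1)%N%:Z + 2) - ((i * p)%N%:Z - j%:Z - 1)
    = m%:Z - g%:Z + j%:Z + 1 + (g%:Z - i%:Z) * p%:Z.
  by rewrite -subzn ?muln_gt0 // !PoszM pE; ring.
by rewrite intrD pF addr0.
Qed.
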